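(* Let $K$ be a field of characteristic $p>0$ (not necessarily algebraically closed) with algebraic closure $\overline K$, and let $f(x)\in K[x]$ be a monic polynomial that has at least two distinct roots in $\overline K$. Write $G_f(\overline K)=\widetilde G_f(\overline K)\rtimes\overline G_f(\overline K)$ where $\overline G_f(\overline K)=\langle\sigma_{\lambda_n,(1-\lambda_n)\nu}\rangle$ and $\widetilde G_f(\overline K)=\{\sigma_{1,\mu}\mid\mu\in\overline V\}$, $\lambda_n\in\overline K$ is a primitive $n$'th root of unity (provided $\overline G_f(\overline K)\ne\{e\}$), $\nu\in\overline K$, and $\overline V$ is a finite dimensional $\mathbb F_p(\lambda_n)$-subspace of $\overline K$. Then $$G_f(K)=\widetilde G_f(K)\rtimes\overline G_f(K)=\mathrm{Aut}_K(K[x])\cap G_f(\overline K),$$ $\widetilde G_f(K)=\mathrm{Sh}_V$ where $V:=K\cap\overline V$, and if $\overline G_f(K)\ne\{e\}$ then $\overline G_f(K)=\langle\sigma_{\lambda_n^i,(1-\lambda_n^i)\nu+\overline v}\rangle$ where $$i=\min\{i'=1,\ldots,n-1\mid i'|n,\ \lambda_n^{i'}\in K,\ (1-\lambda_n^{i'})\nu\in\overline V+K\}$$ and $\overline v\in\overline V$ is any (fixed) element such that $(1-\lambda_n^i)\nu+\overline v\in K$.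
   Context: For a field $L$ of characteristic $p$: $\mathrm{Aut}_L(L[x])=\{\sigma_{\lambda,\mu}\mid\lambda\in L^\times,\mu\in L\}$, $\sigma_{\lambda,\mu}(x)=\lambda x+\mu$; $\mathrm{Sh}(L)=\{\sigma_{1,\mu}\mid\mu\in L\}$; for an $\mathbb F_p$-subspace $V\subseteq L$, $\mathrm{Sh}_V=\{\sigma_{1,v}\mid v\in V\}$. The eigengroup of $f\in L[x]$ is $G_f(L)=\{\sigma\in\mathrm{Aut}_L(L[x])\mid\sigma(f)\in L^\times f\}$. $\mathrm{Aut}_K(K[x])$ is regarded as a subgroup of $\mathrm{Aut}_{\overline K}(\overline K[x])$. When $f$ has at least two distinct roots in $\overline K$, the group $G_f(L)$ is finite ($L=K$ or $\overline K$) and $G_f(L)=\widetilde G_f(L)\rtimes\overline G_f(L)$, where $\widetilde G_f(L)=G_f(L)\cap\mathrm{Sh}(L)$ and $\overline G_f(L)$ is a cyclic complement of the form $\langle\sigma_{\lambda_m,(1-\lambda_m)\nu'}\rangle$ with $\lambda_m\in L$ a primitive $m$'th root of unity and $\nu'\in L$; the complement is a choice (determined up to the choice of such a generator), and the description of $\overline G_f(K)$ means that the indicated cyclic group is such a complement. *)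

(* Defs.v *)
From HB Require Import structures.
From mathcomp Require Import all_boot all_order all_algebra.
From mathcomp Require Import boolp classical_sets.

Set Implicit Arguments.
Unset Strict Implicit.
Unset Printing Implicit Defensive.

Import GRing.Theory.

Local Open Scope classical_set_scope.
Local Open Scope ring_scope.

Section TransformationGroups.
Variable T : Type.
Implicit Types (s t : T -> T) (G N H : set (T -> T)).

(* Automorphism groups are infinite in general, so a group is represented by
   a set of self-maps of T under composition. *)
Definition trans_group G : Prop :=
  [/\ G id,
      forall s t, G s -> G t -> G (s \o t) &
      forall s, G s -> exists2 t, G t & cancel s t /\ cancel t s].

(* The subgroup generated by s.  If s is not bijective, no group contains it
   and this is the set of all self-maps. *)
Definition cyclic_group s : set (T -> T) := smallest trans_group [set s].

Definition normal_in N G : Prop :=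
  forall g h s, G g -> cancel g h -> cancel h g -> N s -> N (g \o s \o h).

(* G is the internal semidirect product of its normal subgroup N and its
   subgroup H. *)
Definition is_sdprod G N H : Prop :=
  [/\ trans_group G,
      trans_group N /\ N `<=` G,
      trans_group H /\ H `<=` G,
      normal_in N G &
      N `&` H = [set id] /\ G = [set n \o h | n in N & h in H]].

End TransformationGroups.

Section Eigengroups.
Variable L : fieldType.
Implicit Types (f q : {poly L}) (s : {poly L} -> {poly L}) (V : set L).

(* Aut_L(L[x]) *)
Definition poly_aut : set ({poly L} -> {poly L}) :=
  [set s | [/\ linear s, monoid_morphism s & bijective s]].

(* The L-algebra endomorphism of L[x] with x |-> lam x + mu. *)
Definition sigma (lam mu : L) : {poly L} -> {poly L} :=
  fun q => q \Po (lam *: 'X + mu%:P).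

Definition shifts V : set ({poly L} -> {poly L}) := [set sigma 1 v | v in V].

Definition eigengroup f : set ({poly L} -> {poly L}) :=
  [set s | poly_aut s /\ exists2 c : L, c != 0 & s f = c *: f].

Definition shift_part f : set ({poly L} -> {poly L}) :=
  eigengroup f `&` shifts setT.

(* H is an admissible choice of the cyclic complement written \overline G_f(L);
   the trivial complement is the case m = 1. *)
Definition cyclic_complement f (H : set ({poly L} -> {poly L})) : Prop :=
  is_sdprod (eigengroup f) (shift_part f) H /\
  exists m lam nu,
    m.-primitive_root lam /\ H = cyclic_group (sigma lam ((1 - lam) * nu)).

Lemma poly_autE :
  poly_aut = [set s | exists2 lam : L, lam != 0 & exists mu, s = sigma lam mu].
Proof.
apply/seteqP; split=> s /=; last first.
  case=> lam lam0 [mu ->]; split.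
  - by move=> a u v; rewrite /sigma comp_polyD comp_polyZ.
  - by split=> [|u v]; rewrite /sigma ?comp_polyM // comp_polyC.
  exists (sigma lam^-1 (- (mu / lam))) => q; rewrite /sigma -comp_polyA.
    rewrite comp_polyD comp_polyZ comp_polyX comp_polyC scalerDr scalerA.
    by rewrite divff // scale1r -!mul_polyC -polyCM mulrN mulrCA divff //
       mulr1 polyCN addrNK comp_polyXr.
  rewrite comp_polyD comp_polyZ comp_polyX comp_polyC scalerDr scalerA.
  by rewrite mulVf // scale1r -!mul_polyC -polyCM polyCN (mulrC lam^-1)
     addrK comp_polyXr.
case=> lins [s1 sM] [g sg gs]; pose q := s 'X.
have sD u v : s (u + v) = s u + s v by have := lins 1 u v; rewrite !scale1r.
have s0 : s 0 = 0 by apply: (addIr (s 0)); rewrite -sD !add0r.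
have sE p : s p = p \Po q.
  elim/poly_ind: p => [|p c IH]; first by rewrite s0 comp_poly0.
  rewrite sD sM IH comp_polyD comp_polyM comp_polyX comp_polyC -/q.
  by rewrite -[c%:P]addr0 -alg_polyC lins s1 s0.
have size_q : size q = 2.
  have := congr1 (fun r : {poly L} => (size r).-1) (gs 'X).
  rewrite /= sE size_comp_poly size_polyX /= => /eqP.
  rewrite muln_eq1 => /andP[_ /eqP].
  by case: (size q) => [|[|[|]]].
exists q`_1; first by move: (lead_coef_eq0 q); rewrite lead_coefE size_q /= => ->;
  rewrite -size_poly_eq0 size_q.
exists q`_0; apply: funext => p; rewrite sE /sigma; congr (_ \Po _).
apply/polyP=> i; rewrite coefD coefZ coefX coefC.
case: i => [|[|i]] /=; rewrite ?mulr0 ?add0r ?mulr1 ?addr0 //.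
by rewrite nth_default ?size_q.
Qed.

(* The subfield generated by z, i.e. F_p(z) when L has characteristic p. *)
Definition prime_adjoin (z : L) : set L :=
  smallest (fun S : set L => GRing.divring_closed [in S]) [set z].

Definition subspace_over (F V : set L) : Prop :=
  [/\ V 0,
      forall u v, V u -> V v -> V (u + v) &
      forall a v, F a -> V v -> V (a * v)].

Definition fin_dim_over (F V : set L) : Prop :=
  exists d (e : 'I_d -> L),
    (forall i, V (e i)) /\
    forall v, V v ->
      exists2 a : 'I_d -> L, (forall i, F (a i)) & v = \sum_(i < d) a i * e i.

End Eigengroups.

(* iota exhibits E as an algebraic closure of K (E being algebraically closed
   by its type). *)
Definition is_alg_closure (K : fieldType) (E : closedFieldType)
    (iota : {rmorphism K -> E}) : Prop :=
  forall z : E, algebraicOver iota z.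

(* A set of automorphisms of K[x], regarded as a set of automorphisms of E[x]
   by extension of scalars along iota. *)
Definition base_ext (K E : fieldType) (iota : {rmorphism K -> E})
    (A : set ({poly K} -> {poly K})) : set ({poly E} -> {poly E}) :=
  [set s | poly_aut s /\
    exists2 t, A t & forall q, s (map_poly iota q) = map_poly iota (t q)].

(* Main.v *)
Require Import Defs.
From HB Require Import structures.
From mathcomp Require Import all_boot all_order all_algebra.
From mathcomp Require Import boolp classical_sets.
From mathcomp Require Import ring.

Set Implicit Arguments.
Unset Strict Implicit.
Unset Printing Implicit Defensive.

Import GRing.Theory.

Local Open Scope classical_set_scope.
Local Open Scope ring_scope.

(* The eigengroup over K consists of the elements of the eigengroup over Kbar
   with coefficients in K.  An element of the latter is sigma (lam ^+ k) b with
   b in (1 - lam ^+ k) * nu + Vbar, so the exponents k of the elements defined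
   over K are closed under subtraction and hence are the multiples of the least
   positive one, i, which divides n.  As the shifts are the kernel of taking
   the leading coefficient, any element over K with leading coefficient
   lam ^+ i generates a complement to them; if lam ^+ i != 1 it has a fixed
   point in K, and so the required form. *)

(** * Calculus of affine substitutions and the structure of eigengroups over one field *)

Section AffineSubstitutions.
Variable L : fieldType.
Implicit Types (a b c d l nu : L) (f q : {poly L}) (s t : {poly L} -> {poly L}).

(** The product substitutes a x + b into c x + d: these operators compose in the opposite order to
    the affine maps, so it is [b] that gets scaled. *)
Lemma sigma_comp a b c d :
  sigma a b \o sigma c d = sigma (a * c) (c * b + d) :> ({poly L} -> {poly L}).
Proof.
apply: funext => q; rewrite /sigma /= -comp_polyA; congr (_ \Po _).
rewrite comp_polyD comp_polyZ comp_polyX comp_polyC scalerDr scalerA.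
by rewrite polyCD polyCM mul_polyC (mulrC c a) addrA.
Qed.

Lemma sigma10 : sigma 1 0 = id :> ({poly L} -> {poly L}).
Proof. by apply: funext => q; rewrite /sigma scale1r addr0 comp_polyXr. Qed.

Lemma sigmaX a b : sigma a b 'X = a *: 'X + b%:P.
Proof. exact: comp_polyX. Qed.

Lemma linear_poly_inj a b c d :
  a *: 'X + b%:P = c *: 'X + d%:P -> a = c /\ b = d.
Proof.
move=> /polyP e; split.
  by have := e 1; rewrite !coefE /= !mulr1 !addr0.
by have := e 0; rewrite !coefE /= !mulr0 !add0r.
Qed.

Lemma sigma_inj a b c d : sigma a b = sigma c d -> a = c /\ b = d.
Proof. by move=> e; apply: linear_poly_inj; rewrite -!sigmaX e. Qed.

Lemma sigma_id a b : sigma a b = id -> a = 1 /\ b = 0.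
Proof. by rewrite -sigma10; apply: sigma_inj. Qed.

Lemma sigmaZ a b c q : sigma a b (c *: q) = c *: sigma a b q.
Proof. exact: comp_polyZ. Qed.

Lemma poly_aut_sigma a b : poly_aut (sigma a b) <-> a != 0.
Proof.
rewrite poly_autE; split=> [[c c0 [d /sigma_inj[-> _]]]//|a0].
by exists a => //; exists b.
Qed.

Definition sigma_inv a b := sigma a^-1 (- (b / a)).

Lemma sigma_invr a b : a != 0 -> sigma a b \o sigma_inv a b = id.
Proof.
by move=> a0; rewrite sigma_comp divff // mulrC subrr sigma10.
Qed.

Lemma sigma_invl a b : a != 0 -> sigma_inv a b \o sigma a b = id.
Proof.
by move=> a0; rewrite sigma_comp mulVf // mulrN mulrC divfK // addNr sigma10.
Qed.

Lemma eigengroupE f s : eigengroup f s ->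
  exists a b, a != 0 /\ s = sigma a b.
Proof.
by case; rewrite poly_autE => -[a a0 [b ->]] _; exists a, b.
Qed.

Lemma eigengroup_id f : eigengroup f id.
Proof.
split; first by rewrite -sigma10; apply/poly_aut_sigma/oner_neq0.
by exists 1; rewrite ?oner_neq0 // scale1r.
Qed.

Lemma eigengroup_comp f s t :
  eigengroup f s -> eigengroup f t -> eigengroup f (s \o t).
Proof.
move=> Gs Gt; have [a [b [a0 es]]] := eigengroupE Gs.
have [c [d [c0 et]]] := eigengroupE Gt.
case: Gs Gt => _ [x x0 sx] [_ [y y0 ty]].
rewrite {}es {}et in sx ty *; split.
  by rewrite sigma_comp; apply/poly_aut_sigma; rewrite mulf_neq0.
by exists (y * x); rewrite ?mulf_neq0 //= ty sigmaZ sx scalerA.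
Qed.

Lemma eigengroup_inv f a b :
  eigengroup f (sigma a b) -> eigengroup f (sigma_inv a b).
Proof.
case=> /poly_aut_sigma a0 [x x0 sx]; split.
  by apply/poly_aut_sigma; rewrite invr_neq0.
exists x^-1; rewrite ?invr_neq0 //.
have := congr1 (@^~ f) (sigma_invl b a0); rewrite /= sx.
by rewrite /sigma_inv sigmaZ => {2}<-; rewrite scalerA mulVf // scale1r.
Qed.

Lemma sigma_inv_cancel a b : a != 0 ->
  cancel (sigma a b) (sigma_inv a b) /\ cancel (sigma_inv a b) (sigma a b).
Proof.
move=> a0; split=> q.
  exact: (congr1 (@^~ q) (sigma_invl b a0)).
exact: (congr1 (@^~ q) (sigma_invr b a0)).
Qed.

Lemma trans_group_eigengroup f : trans_group (eigengroup f).
Proof.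
split; [exact: eigengroup_id | exact: eigengroup_comp|].
move=> s Gs; have [a [b [a0 es]]] := eigengroupE Gs; rewrite es in Gs *.
by exists (sigma_inv a b); [exact: eigengroup_inv | exact: sigma_inv_cancel].
Qed.

Lemma trans_group_shift_part f : trans_group (shift_part f).
Proof.
split.
- by split; [exact: eigengroup_id | exists 0; rewrite ?sigma10].
- move=> s t [Gs [v _ es]] [Gt [w _ et]]; split; first exact: eigengroup_comp.
  by exists (v + w) => //; rewrite -es -et sigma_comp !mul1r.
move=> s [Gs [v _ es]]; rewrite -es in Gs *.
exists (sigma_inv 1 v); last exact/sigma_inv_cancel/oner_neq0.
split; first exact: eigengroup_inv.
by exists (- v) => //; rewrite /sigma_inv invr1 mulr1.
Qed.

(** The leading coefficient is multiplicative under composition, so conjugating a shift leaves it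
    equal to 1. *)
Lemma normal_shift_part f : normal_in (shift_part f) (eigengroup f).
Proof.
move=> g h s Gg gh hg [Gs [v _ es]]; rewrite -{}es in Gs *.
have [a [b [a0 eg]]] := eigengroupE Gg; rewrite {}eg in Gg gh hg *.
(* A two-sided inverse is unique. *)
have -> : h = sigma_inv a b.
  apply: funext => q; rewrite -{2}(hg q).
  by have [-> _] := sigma_inv_cancel b a0.
split.
  exact: eigengroup_comp (eigengroup_comp Gg Gs) (eigengroup_inv Gg).
by rewrite /sigma_inv !sigma_comp mulr1 divff //; eexists.
Qed.

(* Written as a multiple of 1 - l, the constant term makes nu a fixed point of
   x |-> l x + (1 - l) nu, hence of all its powers. *)
Lemma cyclic_groupE m l nu : m.-primitive_root l ->
  cyclic_group (sigma l ((1 - l) * nu)) =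
    [set sigma (l ^+ k) ((1 - l ^+ k) * nu) | k in [set: nat]].
Proof.
move=> prim; have comp j k : sigma (l ^+ j) ((1 - l ^+ j) * nu) \o
    sigma (l ^+ k) ((1 - l ^+ k) * nu) =
    sigma (l ^+ (j + k)) ((1 - l ^+ (j + k)) * nu).
  by rewrite sigma_comp exprD; congr sigma; ring.
apply/seteqP; split.
  apply: smallest_sub; last by move=> _ ->; exists 1; rewrite ?expr1.
  split.
  - by exists 0 => //; rewrite expr0 subrr mul0r sigma10.
  - by move=> _ _ [j _ <-] [k _ <-]; rewrite comp; eexists.
  (* The power [k * m.-1] inverts the k-th power: the exponents add up to [k * m], a multiple of the
     order. *)
  move=> _ [k _ <-]; have e : l ^+ (k + k * m.-1) = 1.
    rewrite -mulnS prednK ?(prim_order_gt0 prim) // mulnC exprM.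
    by rewrite (prim_expr_order prim) expr1n.
  exists (sigma (l ^+ (k * m.-1)) ((1 - l ^+ (k * m.-1)) * nu)); first by eexists.
  split=> q.
    have := congr1 (@^~ q) (comp (k * m.-1)%N k).
    by rewrite addnC e subrr mul0r sigma10.
  have := congr1 (@^~ q) (comp k (k * m.-1)%N).
  by rewrite e subrr mul0r sigma10.
move=> _ [k _ <-] A [[Aid AM _] sA].
elim: k => [|k IH]; first by rewrite expr0 subrr mul0r sigma10.
rewrite -addn1 -comp; apply: AM => //.
by rewrite expr1; apply: sA.
Qed.

(** Dividing an element by the power of the generator with the same leading coefficient leaves a
    shift. A power that is itself a shift is the identity, as its constant term (1 - 1) * nu
    vanishes. *)
Lemma cyclic_complement_sigma f m l nu : m.-primitive_root l ->
    eigengroup f (sigma l ((1 - l) * nu)) ->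
    (forall a b, eigengroup f (sigma a b) -> exists k, a = l ^+ k) ->
  cyclic_complement f (cyclic_group (sigma l ((1 - l) * nu))).
Proof.
move=> prim Gs Gexp; split; last by exists m, l, nu.
have HG : cyclic_group (sigma l ((1 - l) * nu)) `<=` eigengroup f.
  apply: smallest_sub; first exact: trans_group_eigengroup.
  by move=> _ ->.
split.
- exact: trans_group_eigengroup.
- by split; [exact: trans_group_shift_part | move=> s []].
- split=> //; split.
  + by move=> A [[]].
  + move=> s t Hs Ht A AP; have [[_ AM _] _] := AP.
    by apply: AM; [apply: Hs | apply: Ht].
  move=> s Hs; have [a [b [a0 es]]] := eigengroupE (HG _ Hs).
  exists (sigma_inv a b); last by rewrite es; apply: sigma_inv_cancel.
  (* Each group [A] containing the generator supplies its own inverse [t]; uniqueness of inverses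
     identifies them all with [sigma_inv a b]. *)
  move=> A AP; have [[_ _ AV] _] := AP.
  have [t At [st ts]] : exists2 t, A t & cancel s t /\ cancel t s.
    by apply: AV; apply: Hs.
  suff -> : sigma_inv a b = t by [].
  apply: funext => q; rewrite -{1}(ts q) es.
  by have [-> _] := sigma_inv_cancel b a0.
- exact: normal_shift_part.
split.
  apply/seteqP; split=> [s [[_ [v _ <-]]]|_ ->].
    rewrite (cyclic_groupE _ prim) => -[k _ /sigma_inj[-> <-]] /=.
    by rewrite subrr mul0r sigma10.
  split; first by case: (trans_group_shift_part f).
  by move=> A [[]].
apply/seteqP; split=> [s Gs'|_ [s [Gs' _] [t Ht <-]]]; last first.
  exact: eigengroup_comp (HG _ Ht).
have [a [b [a0 es]]] := eigengroupE Gs'; rewrite {}es in Gs' *.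
have [k ea] := Gexp _ _ Gs'.
have Hk : cyclic_group (sigma l ((1 - l) * nu)) (sigma a ((1 - a) * nu)).
  by rewrite (cyclic_groupE _ prim) ea; exists k.
exists (sigma a b \o sigma_inv a ((1 - a) * nu)).
  split; first exact/eigengroup_comp/eigengroup_inv/HG.
  by rewrite sigma_comp divff //; eexists.
exists (sigma a ((1 - a) * nu)) => //.
by rewrite -compA sigma_invl.
Qed.

(** Composing with the inverse on the left gives the difference [c - b] exactly, with no factor
    [a]. *)
Lemma eigengroup_shift f a b c :
    eigengroup f (sigma a b) -> eigengroup f (sigma a c) ->
  shift_part f (sigma 1 (c - b)).
Proof.
move=> Gb Gc; have [/poly_aut_sigma a0 _] := Gb.
split; last by exists (c - b).
have -> : sigma 1 (c - b) = sigma_inv a b \o sigma a c.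
  by rewrite sigma_comp mulVf //; congr sigma; field.
exact/eigengroup_comp/Gc/eigengroup_inv.
Qed.

Lemma shiftsP (V : set L) v : shifts V (sigma 1 v) <-> V v.
Proof. by split=> [[w Vw /sigma_inj[_ <-]]//|Vv]; exists v. Qed.

(** This turns the semidirect product into a condition on coefficients, which can then be tested on
    those coming from a smaller field. *)
Lemma eigengroupP f m l nu (V : set L) : m.-primitive_root l ->
    is_sdprod (eigengroup f) (shift_part f)
      (cyclic_group (sigma l ((1 - l) * nu))) ->
    shift_part f = shifts V ->
  forall a b, eigengroup f (sigma a b) <->
    exists2 k, a = l ^+ k & V (b - (1 - l ^+ k) * nu).
Proof.
move=> prim [_ _ [_ HG] _ [_ GE]] shE a b.
have Gk k : eigengroup f (sigma (l ^+ k) ((1 - l ^+ k) * nu)).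
  by apply: HG; rewrite (cyclic_groupE _ prim); exists k.
split=> [Gab|[k -> Vk]].
  have : [set s \o t | s in shift_part f &
      t in cyclic_group (sigma l ((1 - l) * nu))] (sigma a b) by rewrite -GE.
  case=> _ [_ [v _ <-]] [t].
  rewrite (cyclic_groupE _ prim) => -[k _ <-].
  rewrite sigma_comp mul1r => /sigma_inj[ea _]; exists k => //.
  (* The factorisation has [l ^+ k * v] in its constant term; comparing with [Gk k] instead puts the
     difference itself in [V]. *)
  rewrite -ea in Gab.
  by apply/shiftsP; rewrite -shE; apply: eigengroup_shift Gab.
have -> : sigma (l ^+ k) b = sigma (l ^+ k) ((1 - l ^+ k) * nu) \o
    sigma 1 (b - (1 - l ^+ k) * nu).
  by rewrite sigma_comp mulr1 mul1r addrC subrK.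
apply: eigengroup_comp => //.
by have /shiftsP := Vk; rewrite -shE => -[].
Qed.

End AffineSubstitutions.

(** * Descent of eigengroups and cyclic groups along a field extension *)

Section ScalarExtension.
Variables (K E : fieldType) (iota : {rmorphism K -> E}).
Implicit Types (a b : K) (f q : {poly K}).

Lemma map_sigma a b q :
  map_poly iota (sigma a b q) = sigma (iota a) (iota b) (map_poly iota q).
Proof.
by rewrite /sigma map_comp_poly rmorphD /= map_polyZ map_polyX map_polyC.
Qed.

(** For monic [f] the eigenvalue is the leading coefficient of the transformed polynomial, so it
    already comes from [K]. *)
Lemma eigengroup_map f a b : f \is monic ->
  eigengroup (map_poly iota f) (sigma (iota a) (iota b)) <->
    eigengroup f (sigma a b).
Proof.
move=> f_monic; split=> [] [/poly_aut_sigma a0 [c c0 sf]].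
  rewrite fmorph_eq0 in a0; split; first exact/poly_aut_sigma.
  rewrite -map_sigma in sf; exists (lead_coef (sigma a b f)).
    by rewrite -(fmorph_eq0 iota) -lead_coef_map sf lead_coefZ lead_coef_map
      (monicP f_monic) rmorph1 mulr1.
  apply: (map_poly_inj iota); rewrite map_polyZ sf; congr (_ *: _).
  by rewrite -lead_coef_map sf lead_coefZ lead_coef_map (monicP f_monic)
    rmorph1 mulr1.
split; first by apply/poly_aut_sigma; rewrite fmorph_eq0.
by exists (iota c); rewrite ?fmorph_eq0 // -map_sigma sf map_polyZ.
Qed.

(** An automorphism is determined by its value at ['X], so comparing there identifies the
    extension. *)
Lemma base_extE (A : set ({poly K} -> {poly K})) : A `<=` @poly_aut K ->
  base_ext iota A =
    [set s | exists a b, A (sigma a b) /\ s = sigma (iota a) (iota b)].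
Proof.
move=> sA; apply/seteqP; split=> [s [us [t At st]]|_ [a [b [Ab ->]]]] /=.
  have := sA _ At; rewrite poly_autE => -[a a0 [b et]]; rewrite {}et in At st.
  exists a, b; split=> //.
  move: us; rewrite poly_autE => -[c c0 [d es]]; rewrite {}es in st *.
  have := st 'X; rewrite map_sigma map_polyX !sigmaX.
  by move=> /linear_poly_inj[-> ->].
have /poly_aut_sigma a0 := sA _ Ab.
split; first by apply/poly_aut_sigma; rewrite fmorph_eq0.
by exists (sigma a b) => // q; rewrite map_sigma.
Qed.

Lemma base_ext_cyclic_group m (l nu : K) : m.-primitive_root l ->
  base_ext iota (cyclic_group (sigma l ((1 - l) * nu))) =
    cyclic_group (sigma (iota l) (iota ((1 - l) * nu))).
Proof.
move=> prim; have prim' : m.-primitive_root (iota l).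
  by rewrite fmorph_primitive_root.
rewrite rmorphM rmorphB rmorph1 (cyclic_groupE _ prim').
rewrite base_extE (cyclic_groupE _ prim) /=; last first.
  move=> _ [k _ <-]; apply/poly_aut_sigma/expf_neq0.
  by rewrite (prim_root_eq0 prim) -lt0n (prim_order_gt0 prim).
have sE k : sigma (iota l ^+ k) ((1 - iota l ^+ k) * iota nu) =
    sigma (iota (l ^+ k)) (iota ((1 - l ^+ k) * nu)).
  by rewrite rmorphM rmorphB rmorph1 rmorphXn.
apply/seteqP; split=> [_ [a [b [[k _ /sigma_inj[<- <-]] ->]]]|_ [k _ <-]].
  by exists k.
by exists (l ^+ k), ((1 - l ^+ k) * nu); rewrite sE; split=> //; exists k.
Qed.

End ScalarExtension.

(** Subtracting the least positive element [i] repeatedly from a member of [J] stays in [J], and by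
    minimality can only end at 0. *)
Lemma subn_closed_dvd (J : set nat) n : (0 < n)%N -> J n ->
    (forall j k, (j <= k)%N -> J j -> J k -> J (k - j)%N) ->
  exists i, [/\ (0 < i)%N, J i & forall k, J k -> (i %| k)%N].
Proof.
move=> n0 Jn JB.
have ex : exists i, (0 < i)%N && `[< J i >].
  by exists n; rewrite n0; apply/asboolP.
case: (ex_minnP ex) => i /andP[i0 /asboolP Ji] imin; exists i; split=> //.
move=> k; have [N] := ubnP k; elim: N k => // N IH [//|k] kN Jk.
have ik : (i <= k.+1)%N by apply: imin; apply/asboolP.
rewrite -(subnK ik) dvdn_addl //; apply: IH; last exact: JB.
by rewrite -ltnS; apply: leq_trans kN; rewrite ltnS ltn_subrL i0.
Qed.

(** * The complement over [K] and its least exponent *)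

Theorem theorem4p24 (K : fieldType) (p : nat) (charK : p \in [pchar K])
    (Kbar : closedFieldType) (iota : {rmorphism K -> Kbar})
    (algK : is_alg_closure iota)
    (f : {poly K}) (f_monic : f \is monic)
    (f_roots : exists a b : Kbar,
       [/\ a != b, root (map_poly iota f) a & root (map_poly iota f) b])
    (n : nat) (lam nu : Kbar) (Vbar : set Kbar)
    (decomp : is_sdprod (eigengroup (map_poly iota f))
       (shift_part (map_poly iota f))
       (cyclic_group (sigma lam ((1 - lam) * nu))))
    (lam_prim : cyclic_group (sigma lam ((1 - lam) * nu)) <> [set id] ->
       n.-primitive_root lam)
    (shiftsE : shift_part (map_poly iota f) = shifts Vbar)
    (Vbar_sub : subspace_over (prime_adjoin lam) Vbar)
    (Vbar_fd : fin_dim_over (prime_adjoin lam) Vbar) :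
  let V : set K := iota @^-1` Vbar in
  let I : set nat := [set i | [/\ (1 <= i < n)%N, (i %| n)%N,
    range iota (lam ^+ i) &
    [set v + iota k | v in Vbar & k in [set: K]] ((1 - lam ^+ i) * nu)]] in
  [/\ exists H, cyclic_complement f H,
      base_ext iota (eigengroup f) =
        base_ext iota (@poly_aut K) `&` eigengroup (map_poly iota f),
      shift_part f = shifts V &
      forall H, cyclic_complement f H -> H <> [set id] ->
        exists i, [/\ I i, forall j, I j -> (i <= j)%N,
          exists2 v, Vbar v & range iota ((1 - lam ^+ i) * nu + v) &
          forall v, Vbar v -> range iota ((1 - lam ^+ i) * nu + v) ->
            exists2 H', cyclic_complement f H' &
              base_ext iota H' =
                cyclic_group (sigma (lam ^+ i) ((1 - lam ^+ i) * nu + v))]].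
Proof.
move=> V I.
have Gmap a b := eigengroup_map iota a b f_monic.
(* [lam_prim] says nothing when the complement over [Kbar] is trivial; its generator is then the
   identity, so [lam] is 1, of order [N = 1]. *)
have [N prim Nn] : exists2 N, N.-primitive_root lam & lam = 1 \/ N = n.
  have [triv|/lam_prim] := pselect
    (cyclic_group (sigma lam ((1 - lam) * nu)) = [set id]);
    last by exists n; [|right].
  have : cyclic_group (sigma lam ((1 - lam) * nu)) (sigma lam ((1 - lam) * nu)).
    by move=> A [_ sA]; apply: sA.
  rewrite triv => /sigma_id[-> _]; exists 1%N; last by left.
  apply/andP; split=> //; apply/forallP => j.
  by rewrite ord1 unity_rootE expr1n !eqxx.
have GbarP := eigengroupP prim decomp shiftsE.
have GP a b : eigengroup f (sigma a b) <-> exists2 k, iota a = lam ^+ k &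
    Vbar (iota b - (1 - lam ^+ k) * nu).
  by rewrite -Gmap.
pose J : set nat := [set k | exists a b,
  iota a = lam ^+ k /\ eigengroup f (sigma a b)].
have lam0 k : lam ^+ k != 0.
  have [/poly_aut_sigma] : eigengroup (map_poly iota f)
      (sigma (lam ^+ k) ((1 - lam ^+ k) * nu)).
    apply/GbarP; exists k => //.
    rewrite subrr; apply/shiftsP; rewrite -shiftsE sigma10.
    by case: (trans_group_shift_part (map_poly iota f)).
  by [].
have [i [i0 [a [b [ea Gab]]] Ji]] : exists i,
    [/\ (0 < i)%N, J i & forall k, J k -> (i %| k)%N].
  apply: (subn_closed_dvd (prim_order_gt0 prim)).
    exists 1, 0; rewrite rmorph1 (prim_expr_order prim) sigma10; split=> //.
    exact: eigengroup_id.
  move=> j k jk [a [b [ea Ga]]] [c [d [ec Gc]]].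
  (* These are the coefficients of [sigma_inv a b \o sigma c d]. *)
  exists (a^-1 * c), (c * (- (b / a)) + d); split.
    by rewrite rmorphM fmorphV ea ec -{1}(subnKC jk) exprD mulKf.
  by rewrite -sigma_comp; apply/eigengroup_comp/Gc/eigengroup_inv.
have iN : (i %| N)%N.
  apply: Ji; exists 1, 0; rewrite rmorph1 (prim_expr_order prim) sigma10.
  by split=> //; apply: eigengroup_id.
have prim_a : (N %/ i).-primitive_root a.
  by rewrite -(fmorph_primitive_root iota) ea -{1}(gcdn_idPl iN) exp_prim_root.
have Gexp c d : eigengroup f (sigma c d) -> exists k, c = a ^+ k.
  move=> Gc; have [k ec _] := (GP c d).1 Gc.
  have /dvdnP[q ek] : (i %| k)%N by apply: Ji; exists c, d.
  exists q; apply: (fmorph_inj iota).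
  by rewrite ec rmorphXn ea -exprM mulnC ek.
have complement c : eigengroup f (sigma a ((1 - a) * c)) ->
    cyclic_complement f (cyclic_group (sigma a ((1 - a) * c))).
  by move=> Gc; apply: cyclic_complement_sigma prim_a Gc Gexp.
split.
- have [a1|a1] := eqVneq a 1.
    exists (cyclic_group (sigma a ((1 - a) * 0))); apply: complement.
    by rewrite mulr0 a1 sigma10; apply: eigengroup_id.
  exists (cyclic_group (sigma a ((1 - a) * (b / (1 - a))))); apply: complement.
  by rewrite mulrC divfK // subr_eq0 eq_sym.
- rewrite !base_extE //; last by move=> s [].
  apply/seteqP; split=> [_ [c [d [Gc ->]]]|s [[c [d [_ ->]]] Gc]].
    split; last exact/Gmap.
    by exists c, d; split=> //; case: Gc.
  by exists c, d; split=> //; apply/Gmap.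
- apply/seteqP; split=> [s [Gs [v _ ev]]|_ [v Vv <-]].
    rewrite -ev in Gs *; apply/shiftsP; rewrite /V /=.
    apply/shiftsP; rewrite -shiftsE; split; last by eexists.
    by rewrite -(rmorph1 iota); apply/Gmap.
  split; last by eexists.
  apply/Gmap; rewrite rmorph1.
  by have /shiftsP : Vbar (iota v) := Vv; rewrite -shiftsE => -[].
move=> H [[_ _ [_ HG] _ _] [m [l [mu [priml HE]]]]] Hnt.
have Hl : H (sigma l ((1 - l) * mu)) by rewrite HE; move=> A [_ sA]; apply: sA.
have l1 : l != 1.
  apply/eqP => l1; apply: Hnt; rewrite HE (cyclic_groupE _ priml) l1.
  apply/seteqP; split=> [_ [k _ <-]|_ ->].
    by rewrite expr1n subrr mul0r sigma10.
  by exists 0%N => //; rewrite expr0 subrr mul0r sigma10.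
have [k el] := Gexp _ _ (HG _ Hl).
have a1 : a != 1 by apply: contraNneq l1 => a1; rewrite el a1 expr1n.
(* A nontrivial complement over [K] excludes [lam = 1], so the order of [lam] is [n]. *)
have nN : N = n.
  case: Nn => // lam1; case/eqP: a1; apply: (fmorph_inj iota).
  by rewrite ea lam1 expr1n rmorph1.
have Vb : Vbar (iota b - (1 - lam ^+ i) * nu).
  by have [k' + Vb] := (GP a b).1 Gab; rewrite ea => ->.
(* The shifts by [Vbar] form a group, whence closure under negation. *)
have VN v : Vbar v -> Vbar (- v).
  move=> /shiftsP; rewrite -shiftsE => -[Gv _]; apply/shiftsP.
  rewrite -shiftsE -sub0r; apply: eigengroup_shift Gv _.
  by rewrite sigma10; apply: eigengroup_id.
(* Writing (1 - lam^j) nu as [v + iota d] makes [d] the constant term of an element over [K]; its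
   offset from (1 - lam^j) nu is [- v]. *)
have JI j : I j -> J j.
  case=> _ _ [c _ ec] [v Vv [d _ ed]]; exists c, d; split=> //.
  by apply/GP; exists j => //; rewrite -ed opprD addrCA subrr addr0; apply: VN.
exists i; split.
- split; last 2 first.
  + by exists a.
  + exists (- (iota b - (1 - lam ^+ i) * nu)); first exact: VN.
    by exists b => //; rewrite opprB subrK.
  + rewrite i0 ltn_neqAle -nN (dvdn_leq (prim_order_gt0 prim) iN) andbT.
    (* [i = N] would give [iota a = lam ^+ N = 1]. *)
    apply: contraNneq a1 => eiN.
    by rewrite -(fmorph_eq1 iota) ea eiN (prim_expr_order prim).
  by rewrite -nN.
- move=> j Ij; have [/andP[j0 _] _ _ _] := Ij.
  by apply: dvdn_leq => //; apply/Ji/JI.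
- by exists (iota b - (1 - lam ^+ i) * nu); last exists b; rewrite // addrC subrK.
move=> v Vv [d _ ed].
(* Every admissible [v] gives an element over [K] with leading coefficient [a]; as [a != 1], its
   fixed point [d / (1 - a)] lies in [K]. *)
have Gd : eigengroup f (sigma a d).
  by apply/GP; exists i => //; rewrite ed addrC addKr.
have ed' : d = (1 - a) * (d / (1 - a)).
  by rewrite mulrC divfK // subr_eq0 eq_sym.
exists (cyclic_group (sigma a d)).
  by rewrite ed'; apply: complement; rewrite -ed'.
by rewrite {1}ed' (base_ext_cyclic_group _ _ prim_a) -ed' ea ed.
Qed.
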